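(* Let $\alpha\in[0,1]$. Let $G_1$ be a $t_1$-regular graph of order $n_1$ and size $m_1$, and let $G_2$ be a $t_2$-regular graph of order $n_2$. (a) When $t_1=1$, the $A_\alpha$-spectrum of $G_1\dot\vee_T G_2$ comprises: (i) one simple eigenvalue $\alpha(3+n_2)-1$; (ii) the eigenvalues $2\alpha+\lambda_j(A_\alpha(G_2))$ for $j=2,3,\ldots,n_2$; and (iii) three eigenvalues obtained by solving $$(\nu-2\alpha)(\nu-2\alpha -t_2)(\nu-1-\alpha -\alpha n_2) -2n_2(1-\alpha)^2(\nu-2\alpha) -2(1-\alpha)^2(\nu-2\alpha -t_2)=0.$$ (b) When $t_1\ge2$, the $A_\alpha$-spectrum of $G_1\dot\vee_T G_2$ comprises: (i) one eigenvalue $2\alpha(t_1+1)-2$ with multiplicity $m_1-n_1$; (ii) the eigenvalues $\alpha n_1+\lambda_j(A_\alpha(G_2))$ for $j=2,3,\ldots,n_2$; (iii) the eigenvalues obtained by solving, for each $i=2,3,\ldots,n_1$, the equation $$\begin{aligned}&\nu^2 -\big(\alpha(t_1 +n_2 +2) +t_1 -2 +2\lambda_i(A_{\alpha}(G_1))\big)\nu -(1-\alpha)\big(t_1-2\alpha t_1 + \lambda_i(A_\alpha(G_1))\big)\\ &+ \big( \alpha t_1 + \alpha n_2 + \lambda_i(A_\alpha(G_1))\big) \big(t_1 -2 +2\alpha +\lambda_i(A_\alpha(G_1)) \big)=0;\end{aligned}$$ and (iv) three eigenvalues obtained by solving the equation $$(\nu-t_2 -\alpha n_1)(\nu- t_1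 -\alpha t_1 -\alpha n_2)(\nu+2 -2t_1-2\alpha) -2t_1 (1-\alpha)^2(\nu-\alpha n_1 -t_2) -n_1 n_2(1-\alpha)^2(\nu +2 -2t_1-2\alpha)=0.$$
   Context: All graphs are undirected and simple. For a graph $G$ with adjacency matrix $A(G)$ and diagonal degree matrix $D(G)$, put $A_\alpha(G)=\alpha D(G)+(1-\alpha)A(G)$. The $A_\alpha$-spectrum of $G$ is the multiset of eigenvalues of $A_\alpha(G)$. Eigenvalues of a symmetric $n\times n$ matrix $M$ are ordered $\lambda_1(M)\ge\cdots\ge\lambda_n(M)$. The order of a graph is its number of vertices and its size is its number of edges. The total graph $T(G)$ is obtained from $G$ (keeping all its vertices and edges) by adding one new vertex for every edge of $G$, making each new vertex adjacent to the two end vertices of the corresponding edge, and making two new vertices adjacent whenever their corresponding (distinct) edges share an endpoint in $G$. The $T$-vertex join $G_1\dot\vee_T G_2$ is obtained from the disjoint union of $T(G_1)$ and $G_2$ by joining each original vertex of $G_1$ in $T(G_1)$ to every vertex of $G_2$.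
   Formalization: Part (a) is stated for n_1=2 (G_1=K_2) only: for a 1-regular G_1 with n_1≥4 the claim is false, as it lists n_2+3 eigenvalues while the graph has 3n_1/2+n_2 vertices; both graphs are assumed to be nonempty. *)

(* Defs.v *)
From HB Require Import structures.
From mathcomp Require Import all_boot all_order all_algebra.
From mathcomp Require Import polyrcf.

Set Implicit Arguments.
Unset Strict Implicit.
Unset Printing Implicit Defensive.

Import Order.TTheory GRing.Theory Num.Theory.

Record sgraph := SGraph {
  vertex :> finType;
  adj : rel vertex;
  adj_sym : symmetric adj;
  adj_irrefl : irreflexive adj }.

Arguments adj {s} x y.

Section Graphs.
Variable G : sgraph.

Definition degree (x : G) : nat := #|[set y : G | adj x y]|.

Definition regular (t : nat) : Prop := forall x : G, degree x = t.

Definition edges : {set {set G}} :=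
  [set E : {set G} | [exists x : G, exists y : G, adj x y && (E == [set x; y])]].

Definition gorder : nat := #|G|.
Definition gsize : nat := #|edges|.

Definition edge : finType := {E : {set G} | E \in edges}.

Definition total_adj (u v : G + edge) : bool :=
  match u, v with
  | inl x, inl y => adj x y
  | inl x, inr E => x \in val E
  | inr E, inl x => x \in val E
  | inr E, inr F => (E != F) && (val E :&: val F != set0)
  end.

Lemma total_adj_sym : symmetric total_adj.
Proof.
by move=> [x|E] [y|F] //=; [exact: adj_sym | rewrite eq_sym setIC].
Qed.

Lemma total_adj_irrefl : irreflexive total_adj.
Proof. by move=> [x|E] /=; [exact: adj_irrefl | rewrite eqxx]. Qed.

Definition total_graph : sgraph := SGraph total_adj_sym total_adj_irrefl.

End Graphs.

Section VertexJoin.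
Variables G1 G2 : sgraph.

Definition original (a : total_graph G1) : bool :=
  if a is inl _ then true else false.

Definition T_vjoin_adj (u v : total_graph G1 + G2) : bool :=
  match u, v with
  | inl a, inl b => adj a b
  | inr x, inr y => adj x y
  | inl a, inr _ => original a
  | inr _, inl b => original b
  end.

Lemma T_vjoin_adj_sym : symmetric T_vjoin_adj.
Proof.
move=> [a|x] [b|y] //.
- exact: (@adj_sym (total_graph G1) a b).
- exact: (@adj_sym G2 x y).
Qed.

Lemma T_vjoin_adj_irrefl : irreflexive T_vjoin_adj.
Proof.
by move=> [a|x]; [exact: (@adj_irrefl (total_graph G1) a) | exact: (@adj_irrefl G2 x)].
Qed.

Definition T_vjoin : sgraph := SGraph T_vjoin_adj_sym T_vjoin_adj_irrefl.

End VertexJoin.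

Local Open Scope ring_scope.

(* Rows and columns follow the enumeration of the vertex type; the spectrum
   does not depend on this choice. *)
Definition adj_mx (R : nzRingType) (G : sgraph) : 'M[R]_#|G| :=
  \matrix_(i, j) (adj (enum_val i) (enum_val j))%:R.

Definition deg_mx (R : nzRingType) (G : sgraph) : 'M[R]_#|G| :=
  diag_mx (\row_i (degree (enum_val i))%:R).

Definition A_mx (R : nzRingType) (alpha : R) (G : sgraph) : 'M[R]_#|G| :=
  alpha *: deg_mx R G + (1 - alpha) *: adj_mx R G.

(* Real roots, each repeated according to its multiplicity (rootsR lists the
   distinct ones); the order of the list is immaterial. *)
Definition real_roots (R : rcfType) (p : {poly R}) : seq R :=
  flatten [seq nseq (mup x p) x | x <- rootsR p].

(* Meant for symmetric M: the characteristic polynomial then splits over R and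
   algebraic and geometric multiplicities agree. *)
Definition spectrum (R : rcfType) (n : nat) (M : 'M[R]_n) : seq R :=
  sort >=%R (real_roots (char_poly M)).

(* The i-th largest eigenvalue, counted from i = 1. *)
Definition lambda (R : rcfType) (n : nat) (i : nat) (M : 'M[R]_n) : R :=
  nth 0 (spectrum M) i.-1.

(* Main.v *)
Require Import Defs.
From HB Require Import structures.
From mathcomp Require Import all_boot all_order all_algebra.
From mathcomp Require Import polyrcf.
From mathcomp Require Import perm complex ring lra.

Set Implicit Arguments.
Unset Strict Implicit.
Unset Printing Implicit Defensive.

Import Order.TTheory GRing.Theory Num.Theory.
Local Open Scope ring_scope.

(* Write N_i for A_alpha(G_i), c = 1 - alpha, and B for the vertex-edge incidence
   matrix of G_1, so that B B^T = A(G_1) + t_1 I, while B^T B - 2 I is the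
   adjacency matrix of the line graph. Eliminating the vertices of G_2 and then
   the edge vertices by Schur complements expresses the characteristic polynomial
   of the join through a quadratic polynomial in N_1, up to a rank one
   perturbation by the all-ones matrix. Since N_1 is diagonalizable with
   eigenvector 1 for its largest eigenvalue t_1, the perturbation only changes the
   factor of t_1, where it turns a quadratic times (x - alpha n_1 - t_2) into the
   cubic. Sylvester's identity accounts for the factor of B^T B, at the price of
   powers of q = x - 2 alpha (t_1 + 1) + 2 with exponents n_1 and m_1 on the two
   sides. If t_1 >= 2 then n_1 <= m_1 and q^n_1 cancels; if t_1 = 1 and n_1 = 2,
   the missing q is a factor of the only remaining quadratic. *)

(** If [p - q] were nonzero, its product with [r] would vanish at more naturals than its size
    allows. Determinant identities thus need checking only where the inverses involved exist; with
    [r = 1] this is extensionality. *)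
Lemma poly_eq_off_roots (R : numDomainType) (p q r : {poly R}) :
  r != 0 -> (forall x, r.[x] != 0 -> p.[x] = q.[x]) -> p = q.
Proof.
move=> r0 E; apply/eqP; rewrite -subr_eq0; apply/negPn/negP => d0.
have prodn0 : (p - q) * r != 0 by rewrite mulf_neq0.
pose s := [seq k%:R : R | k <- iota 0 (size ((p - q) * r))].
have /(max_poly_roots prodn0) : all (root ((p - q) * r)) s.
  apply/allP => x _; rewrite rootE hornerM !hornerE.
  by have [->|/E ->] := eqVneq r.[x] 0; rewrite ?mulr0 // subrr mul0r.
have us : uniq s.
  rewrite map_inj_uniq ?iota_uniq // => i j /eqP.
  by rewrite eqr_nat => /eqP.
by move=> /(_ us); rewrite size_map size_iota ltnn.
Qed.

(** * Real roots counted with multiplicity *)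

Section RealRoots.
Variable R : rcfType.
Implicit Types (p q : {poly R}) (s : seq R).

Lemma count_real_roots p x : p != 0 -> count_mem x (real_roots p) = mup x p.
Proof.
move=> p0; rewrite /real_roots count_flatten -map_comp sumnE big_map.
have [ux rx] : uniq (rootsR p) /\ (x \in rootsR p) = root p x.
  split; first exact: uniq_roots.
  by have /(_ x) := roots_on_rootsR p0; rewrite /= => <-.
have E y : (count_mem x \o (fun y => nseq (mup y p) y)) y
           = (if y == x then mup x p else 0%N).
  by rewrite /= count_nseq /=; case: eqP => [->|_]; rewrite ?mul1n.
rewrite (eq_bigr _ (fun y _ => E y)) -big_mkcond /=.
have [xr|xNr] := boolP (x \in rootsR p).
  rewrite -big_filter (_ : [seq y <- _ | _] = [:: x]) ?big_seq1 //.
  by rewrite filter_pred1_uniq.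
by rewrite mupNroot -?rx // big1.
Qed.

Lemma real_rootsM p q : p != 0 -> q != 0 ->
  perm_eq (real_roots (p * q)) (real_roots p ++ real_roots q).
Proof.
move=> p0 q0; apply/allP => x _ /=.
by rewrite count_cat !count_real_roots ?mulf_neq0 // mupM.
Qed.

Lemma real_roots_split s :
  perm_eq (real_roots (\prod_(x <- s) ('X - x%:P))) s.
Proof.
have p0 : \prod_(x <- s) ('X - x%:P) != 0 by exact/monic_neq0/monic_prod_XsubC.
by apply/allP => x _ /=; rewrite count_real_roots // mu_prod_XsubC.
Qed.

Lemma real_roots1 : real_roots (1 : {poly R}) = [::].
Proof. by rewrite /real_roots rootsRC. Qed.

Lemma real_roots_prod (I : Type) (r : seq I) (F : I -> {poly R}) :
  (forall i, F i != 0) ->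
  perm_eq (real_roots (\prod_(i <- r) F i))
          (flatten [seq real_roots (F i) | i <- r]).
Proof.
move=> F0; elim: r => [|i r IHr] /=; first by rewrite big_nil real_roots1.
rewrite big_cons (permPl (real_rootsM _ _)) ?perm_cat2l //.
by elim/big_ind: _ => //; [exact: oner_neq0 | exact: mulf_neq0].
Qed.

(** A divisor of a split polynomial is itself split. This will give the cubic its three real roots,
    as a factor of the characteristic polynomial of a symmetric matrix. *)
Lemma size_real_roots_dvd p s : p != 0 ->
  p %| \prod_(x <- s) ('X - x%:P) -> size (real_roots p) = (size p).-1.
Proof.
move=> p0 /dvdp_prod_XsubC[m]; set t := mask m s => pt.
have /eqpf_eq[k k0 ->] : p %= \prod_(x <- t) ('X - x%:P) by [].
have t0 : \prod_(x <- t) ('X - x%:P) != 0 by exact/monic_neq0/monic_prod_XsubC.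
have k'0 : k%:P != 0 by rewrite polyC_eq0.
rewrite -mul_polyC (perm_size (real_rootsM k'0 t0)).
rewrite size_cat (perm_size (real_roots_split t)) mul_polyC size_scale //.
by rewrite size_prod_XsubC /= /real_roots rootsRC.
Qed.

End RealRoots.

Lemma horner_char_poly (R : comNzRingType) n (M : 'M[R]_n) x :
  (char_poly M).[x] = \det (x%:M - M).
Proof.
rewrite -[LHS]/(horner_eval x _) /char_poly -det_map_mx /char_poly_mx.
rewrite map_mxB map_scalar_mx /= /horner_eval hornerX -map_mx_comp.
by rewrite map_mx_id // => y /=; rewrite hornerC.
Qed.

Lemma det_conj n (F : fieldType) (P D : 'M[F]_n) : P \in unitmx ->
  \det (invmx P *m D *m P) = \det D.
Proof.
by move=> Pu; rewrite -mulmxA !det_mulmx mulrCA -det_mulmx mulVmx // det1 mulr1.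
Qed.

(** * Spectral theorem for real symmetric matrices *)

Section SymmetricSpectrum.
Variable R : rcfType.
Local Notation toC := (map_mx (real_complex R)).

(** Over [R[i]] the matrix is hermitian, so the spectral theorem applies and its eigenvalues are
    real. Only [d] descends to [R]; a complex [P] is enough for determinants. *)
Lemma symmetric_diagonalization n (M : 'M[R]_n) : M^T = M ->
  exists d : 'rV[R]_n, exists2 P : 'M[R[i]]_n, P \in unitmx &
    toC M = invmx P *m diag_mx (toC d) *m P.
Proof.
move=> symM; have herm : toC M \is hermsymmx.
  apply: realsym_hermsym.
    apply/is_hermitianmxP.
    by rewrite expr0 scale1r map_mx_id // map_trmx symM.
  by apply/mxOverP => i j; rewrite mxE complex_real.
have := hermitian_spectral_diag_real herm.
have := orthomx_spectralP (hermitian_normalmx herm).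
have := spectral_unit (toC M).
move: (spectralmx _) (spectral_diag _) => P D Pu E /mxOverP realD.
exists (map_mx (@complex.Re R) D); exists P; first exact: Pu.
suff DE : toC (map_mx (@complex.Re R) D) = D by rewrite DE; exact: E.
by apply/matrixP => i j; rewrite !mxE; exact: RRe_real.
Qed.

(** The same [d] serves both conclusions, because conjugation by [P] diagonalizes every polynomial
    in [M]. Determinants computed over [R[i]] come back to [R] by injectivity of the embedding. *)
Lemma symmetric_eigenvalues n (M : 'M[R]_n) : M^T = M ->
  exists2 d : 'rV[R]_n, char_poly M = \prod_j ('X - (d 0 j)%:P) &
    forall u v w : R, \det (u%:M + v *: M + w *: (M *m M))
      = \prod_j (u + v * d 0 j + w * d 0 j ^+ 2).
Proof.
move=> /symmetric_diagonalization[d [P Pu E]].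
have detE u v w : \det (u%:M + v *: M + w *: (M *m M))
      = \prod_j (u + v * d 0 j + w * d 0 j ^+ 2).
  apply: (fmorph_inj (real_complex R)); rewrite -det_map_mx !map_mxD.
  rewrite !map_mxZ map_mxM map_scalar_mx E rmorph_prod.
  set D := diag_mx _.
  have -> : (real_complex R u)%:M + real_complex R v *: (invmx P *m D *m P)
     + real_complex R w *: (invmx P *m D *m P *m (invmx P *m D *m P))
     = invmx P *m ((real_complex R u)%:M + real_complex R v *: D
                   + real_complex R w *: (D *m D)) *m P.
    rewrite !mulmxA mulmxK // !mulmxDr !mulmxDl -!scalemxAr -!scalemxAl.
    by rewrite mulmxA mul_mx_scalar -scalemxAl mulVmx // scalemx1.
  rewrite det_conj // mulmx_diag -!diag_const_mx -!linearZ -!linearD /=.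
  rewrite det_diag; apply: eq_bigr => j _.
  by rewrite !mxE !rmorphD !rmorphM.
exists d => //; apply: (@poly_eq_off_roots _ _ _ 1); rewrite ?oner_neq0 // => x _.
rewrite horner_char_poly horner_prod.
(* The characteristic polynomial is the case [v = -1], [w = 0]. *)
have := detE x (-1) 0; rewrite !scale0r addr0 scaleN1r.
move=> ->; apply: eq_bigr => j _; rewrite !hornerE; ring.
Qed.

(** [spectrum] collects only real roots; diagonalization shows that no root is lost. *)
Lemma char_poly_symmetric n (M : 'M[R]_n) : M^T = M ->
  char_poly M = \prod_(l <- spectrum M) ('X - l%:P).
Proof.
move=> /symmetric_eigenvalues[d E _].
apply/esym; rewrite E -(big_map (d 0) xpredT (fun x => 'X - x%:P)).
apply: perm_big; rewrite /spectrum perm_sort E.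
by rewrite -(big_map (d 0) xpredT (fun x => 'X - x%:P)) real_roots_split.
Qed.

Lemma det_quadratic_symmetric n (M : 'M[R]_n) (u v w : R) : M^T = M ->
  \det (u%:M + v *: M + w *: (M *m M))
  = \prod_(l <- spectrum M) (u + v * l + w * l ^+ 2).
Proof.
move=> /symmetric_eigenvalues[d E ->].
rewrite -(big_map (d 0) xpredT (fun l => u + v * l + w * l ^+ 2)).
apply/esym/perm_big; rewrite /spectrum perm_sort E.
by rewrite -(big_map (d 0) xpredT (fun x => 'X - x%:P)) real_roots_split.
Qed.

Lemma size_spectrum n (M : 'M[R]_n) : M^T = M -> size (spectrum M) = n.
Proof.
move=> /char_poly_symmetric/(congr1 (fun p : {poly R} => size p)).
by rewrite size_char_poly size_prod_XsubC => -[].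
Qed.

(** Both sides are read off the coefficient just below the leading one. This yields the second
    eigenvalue when [G1] has two vertices. *)
Lemma sum_spectrum n (M : 'M[R]_n) : M^T = M ->
  \sum_(l <- spectrum M) l = \tr M.
Proof.
move=> symM; case: n M symM => [|n] M symM.
  by rewrite (size0nil (size_spectrum symM)) big_nil /mxtrace big_ord0.
have := char_poly_trace M isT; rewrite char_poly_symmetric //=.
have := size_spectrum symM; set s := spectrum M => ss.
have := @coefPn_prod_XsubC _ s; rewrite ss => /(_ isT) /= -> /oppr_inj.
by [].
Qed.


End SymmetricSpectrum.

(** * Determinants by Schur complements *)

Section BlockDeterminants.
Variable F : fieldType.

Lemma det_schur_dr n m (A : 'M[F]_n) (B : 'M_(n, m)) (C : 'M_(m, n)) (D : 'M_m) :
  D \in unitmx ->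
  \det (block_mx A B C D) = \det D * \det (A - B *m invmx D *m C).
Proof.
move=> Du; have -> : block_mx A B C D
  = block_mx (A - B *m invmx D *m C) B 0 D *m block_mx 1%:M 0 (invmx D *m C) 1%:M.
  rewrite mulmx_block !mulmx0 !mulmx1 !add0r !mulmxA mulmxV // mul1mx.
  by rewrite subrK.
by rewrite det_mulmx det_ublock det_lblock !det1 !mulr1 mulrC.
Qed.

Lemma det_schur_ul n m (A : 'M[F]_n) (B : 'M_(n, m)) (C : 'M_(m, n)) (D : 'M_m) :
  A \in unitmx ->
  \det (block_mx A B C D) = \det A * \det (D - C *m invmx A *m B).
Proof.
move=> Au; have -> : block_mx A B C D
  = block_mx 1%:M 0 (C *m invmx A) 1%:M *m block_mx A B 0 (D - C *m invmx A *m B).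
  rewrite mulmx_block !mul0mx !mul1mx !addr0 mulmxKV //.
  by rewrite addrC subrK.
by rewrite det_mulmx det_ublock det_lblock !det1 !mul1r.
Qed.

(** Equate the two Schur complement formulas for the block matrix with diagonal blocks [1] and [q];
    the power [q ^+ n] clears the inverse of [q]. *)
Lemma det_sylvester n m (B : 'M[F]_(n, m)) (C : 'M_(m, n)) (q : F) : q != 0 ->
  q ^+ n * \det (q%:M - C *m B) = q ^+ m * \det (q%:M - B *m C).
Proof.
move=> q0; have qu : q%:M \in @unitmx F m
  by rewrite unitmxE det_scalar unitfE expf_neq0.
have := det_schur_dr 1%:M B C qu; rewrite det_schur_ul ?unitmx1 //.
rewrite det1 mul1r invmx1 mulmx1 => ->; rewrite det_scalar mulrCA -detZ.
rewrite scalerBr invmx_scalar mul_mx_scalar -scalemxAl scalerA divff //.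
by rewrite scale1r scalemx1.
Qed.

(** The matrix determinant lemma, from both Schur complements of the block matrix with diagonal
    blocks [A] and [1]. *)
Lemma det_rank1_update n (A : 'M[F]_n) (u : 'cV_n) (v : 'rV_n) : A \in unitmx ->
  \det (A - u *m v) = \det A * (1 - (v *m invmx A *m u) 0 0).
Proof.
move=> Au; have := det_schur_ul u v 1%:M Au.
rewrite det_schur_dr ?unitmx1 // det1 mul1r invmx1 mulmx1 => ->.
by rewrite det_mx11 !mxE.
Qed.

End BlockDeterminants.

(** * Matrices with constant row sums *)

Section RowSums.
Variable F : fieldType.

Lemma mulmx_const1 n k (A : 'M[F]_n) (t : F) : (forall i, \sum_j A i j = t) ->
  A *m const_mx 1 = const_mx t :> 'M_(n, k).
Proof.
move=> At; apply/matrixP => i j; rewrite !mxE -(At i).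
by apply: eq_bigr => l _; rewrite mxE mulr1.
Qed.

Lemma invmx_mul_const1 n k (A : 'M[F]_n) (t : F) : A \in unitmx -> t != 0 ->
  A *m const_mx 1 = const_mx t :> 'M_(n, k) ->
  invmx A *m const_mx 1 = const_mx t^-1 :> 'M_(n, k).
Proof.
move=> Au t0 At; apply: (can_inj (mulKmx Au)); rewrite mulKVmx //.
have -> : const_mx t^-1 = t^-1 *: const_mx 1 :> 'M_(n, k).
  by apply/matrixP => i j; rewrite !mxE mulr1.
by rewrite -scalemxAr At; apply/matrixP => i j; rewrite !mxE mulVf.
Qed.

Lemma mulmx_const n m k (a b : F) :
  (const_mx a : 'M_(n, m)) *m (const_mx b : 'M_(m, k)) = const_mx (m%:R * (a * b)).
Proof.
apply/matrixP => i j; rewrite !mxE; under eq_bigr do rewrite !mxE.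
by rewrite sumr_const card_ord mulr_natl.
Qed.

End RowSums.

(* Eliminate the second graph, then the edge vertices; multiplying the remaining
   Schur complement by [q'%:M - N1] clears the inverse because
   [(q'%:M - N1) *m B = B *m Q], and a rank one update of a quadratic polynomial
   in [N1] is left. *)
Lemma det_total_join (F : fieldType) n1 m n2 (N1 : 'M[F]_n1) (N2 : 'M[F]_n2)
    (B : 'M[F]_(n1, m)) (p q s c e t1 t2 : F) :
    let q' := q - e in
    let Q := q%:M - c *: (B^T *m B) in
    let S := s%:M - N2 in
    let P2 := (p * q' - c * e)%:M + (- (p + q' + c)) *: N1 + 1 *: (N1 *m N1) in
    let f := p * q' - c * e + - (p + q' + c) * t1 + 1 * t1 ^+ 2 in
    c *: (B *m B^T) = N1 + e%:M ->
    (forall i, \sum_j N1 i j = t1) -> (forall i, \sum_j N2 i j = t2) ->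
    q != 0 -> Q \in unitmx -> S \in unitmx -> P2 \in unitmx ->
    f != 0 -> s - t2 != 0 ->
  q ^+ n1 * \det (block_mx
      (block_mx (p%:M - N1) (- c *: B) (- c *: B^T) Q)
      (col_mx (const_mx (- c)) 0) (row_mx (const_mx (- c)) 0) S)
  = q ^+ m * \det S * \det P2
    * (1 - c ^+ 2 * n1%:R * n2%:R * (q' - t1) / ((s - t2) * f)).
Proof.
move=> q' Q S P2 f BB N1t N2t q0 Qu Su P2u f0 s0.
have N1J k : N1 *m const_mx 1 = const_mx t1 :> 'M_(n1, k) by exact: mulmx_const1.
have N2J k : N2 *m const_mx 1 = const_mx t2 :> 'M_(n2, k) by exact: mulmx_const1.
have SJ : invmx S *m const_mx 1 = const_mx (s - t2)^-1 :> 'M_(n2, n1).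
  apply: invmx_mul_const1 => //; rewrite mulmxBl N2J mul_scalar_mx.
  by apply/matrixP => i j; rewrite !mxE mulr1.
(* [f] is the eigenvalue of [P2] at the all-ones vector: the quadratic evaluated at [t1]. *)
have P2J : invmx P2 *m const_mx 1 = const_mx f^-1 :> 'M_(n1, 1).
  apply: invmx_mul_const1 => //.
  rewrite !mulmxDl mul_scalar_mx -!scalemxAl -mulmxA N1J.
  have -> : const_mx t1 = t1 *: const_mx 1 :> 'M_(n1, 1).
    by apply/matrixP => i j; rewrite !mxE mulr1.
  rewrite -scalemxAr N1J.
  by apply/matrixP => i j; rewrite !mxE /f; ring.
(* [c ^+ 2] times the sum of all entries of [invmx S], whose [n2] rows each sum to [(s - t2)^-1]. *)
pose k := c ^+ 2 * n2%:R / (s - t2).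
have step1 : col_mx (const_mx (- c)) 0 *m invmx S *m row_mx (const_mx (- c)) 0
    = block_mx (const_mx k) 0 0 0 :> 'M_(n1 + m).
  have cJ a b : const_mx (- c) = - c *: const_mx 1 :> 'M[F]_(a, b).
    by apply/matrixP => i j; rewrite !mxE mulr1.
  rewrite -mulmxA mul_mx_row mulmx0 mul_col_row !mul0mx !mulmx0.
  rewrite [X in invmx S *m X]cJ -scalemxAr SJ -scalemxAr mulmx_const.
  congr (block_mx _ _ _ _); apply/matrixP => i j; rewrite !mxE /k; ring.
rewrite (det_schur_dr _ _ _ Su) step1 opp_block_mx add_block_mx !oppr0 !addr0.
rewrite (det_schur_dr _ _ _ Qu).
set X := _ - _ - _; pose H := q'%:M - N1.
(* Multiplication by [H] scales the constant block by [q' - t1], the row sum of [H], so it remains a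
   column times a row. *)
have HX : H *m X
    = P2 - (const_mx (k * (q' - t1)) : 'cV_n1) *m (const_mx 1 : 'rV_n1).
  have HB : H *m B = B *m Q.
    have -> : H = q%:M - c *: (B *m B^T).
      by rewrite BB /H /q' raddfB /= opprD addrA addrAC.
    rewrite mulmxBl mulmxBr mul_scalar_mx mul_mx_scalar -scalemxAl -scalemxAr.
    by rewrite mulmxA.
  rewrite /X -!scalemxAl -!scalemxAr scalerA mulrNN mulmxBr -scalemxAr.
  rewrite !mulmxA HB mulmxK // -scalerA BB mulmxBr mulmx_const.
  have -> : H *m const_mx k = const_mx (k * (q' - t1)) :> 'M_n1.
    have -> : const_mx k = k *: const_mx 1 :> 'M_n1.
      by apply/matrixP => i j; rewrite !mxE mulr1.
    rewrite -scalemxAr mulmxBl N1J mul_scalar_mx.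
    by apply/matrixP => i j; rewrite !mxE mulr1.
  rewrite mulr1 mul1r /H mulmxBl !mulmxBr -scalar_mxM mul_scalar_mx.
  rewrite mul_mx_scalar /P2.
  move: (N1 *m N1) => N1N1.
  by apply/matrixP => i j; rewrite !mxE; ring.
(* Since [c *: (B *m B^T) = N1 + e%:M], Sylvester's identity trades [\det Q] for [\det H]. The
   factor [H] is thus absorbed without being inverted. *)
have sylv := @det_sylvester _ n1 m B (c *: B^T) q q0.
rewrite -scalemxAl -scalemxAr BB in sylv.
have qH : q%:M - (N1 + e%:M) = H by rewrite /H /q' raddfB /= opprD addrA addrAC.
rewrite qH -/Q in sylv.
have {sylv}E : q ^+ n1 * (\det Q * \det X) = q ^+ m * \det (H *m X).
  by rewrite det_mulmx !mulrA sylv.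
rewrite mulrCA E HX det_rank1_update // -mulmxA.
have -> : const_mx (k * (q' - t1)) = k * (q' - t1) *: const_mx 1 :> 'cV_n1.
  by apply/matrixP => i j; rewrite !mxE mulr1.
rewrite -!scalemxAr P2J mulmx_const !mxE /k.
move: (\det _) (\det _) (q ^+ m) => dS dP qm.
by field; rewrite f0 s0.
Qed.

(** * Counting incidences between vertices and edges *)

Section Incidence.
Variable G : sgraph.
Implicit Types (x y : G) (E F : edge G).

Lemma degreeE x : degree x = (\sum_(y : G) adj x y)%N.
Proof.
rewrite /degree -sum1dep_card big_mkcond /=.
by apply: eq_bigr => y _; case: adj.
Qed.

Lemma edgeP E : exists x y, adj x y /\ val E = [set x; y].
Proof.
have := valP E; rewrite inE => /existsP[x /existsP[y /andP[xy /eqP]]].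
by exists x, y.
Qed.

Lemma adj_neq x y : adj x y -> x != y.
Proof. by apply: contraTneq => ->; rewrite adj_irrefl. Qed.

Lemma card_edge E : #|val E| = 2%N.
Proof. by have [x [y [/adj_neq xy ->]]] := edgeP E; rewrite cards2 xy. Qed.

Lemma edge_of_mem E x y : x != y -> x \in val E -> y \in val E ->
  val E = [set x; y] /\ adj x y.
Proof.
move=> xy xE yE; have EE : val E = [set x; y].
  apply/esym/eqP; rewrite eqEcard card_edge cards2 xy leqnn andbT.
  by apply/subsetP => z; rewrite !inE => /orP[] /eqP ->.
split=> //; have [a [b [ab Eab]]] := edgeP E.
move: xE yE xy; rewrite Eab !inE.
by move=> /orP[] /eqP -> /orP[] /eqP ->; rewrite ?eqxx // adj_sym.
Qed.

Lemma sum_mem_edge E : (\sum_(x : G) (x \in val E) = 2)%N.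
Proof.
rewrite -(card_edge E) -sum1_card [RHS]big_mkcond /=.
by apply: eq_bigr => y _; case: (y \in _).
Qed.

(** In a simple graph two distinct vertices lie on at most one common edge. These sums are the
    off-diagonal entries of the product of the incidence matrix with its transpose. *)
Lemma sum_edges_mem2 x y : x != y ->
  (\sum_(E : edge G) (x \in val E) * (y \in val E) = adj x y)%N.
Proof.
move=> xy; have [axy|naxy] := boolP (adj x y); last first.
  rewrite big1 // => E _; apply/eqP; rewrite mulnb eqb0.
  apply: contra naxy => /andP[xE yE].
  by have [] := edge_of_mem xy xE yE.
have E0P : [set x; y] \in edges G.
  by rewrite inE; apply/existsP; exists x; apply/existsP; exists y; rewrite axy /=.
pose E0 : edge G := Sub [set x; y] E0P.
rewrite (bigD1 E0) //= big1 ?addn0 ?set21 ?set22 // => E EE0.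
apply/eqP; rewrite mulnb eqb0; apply: contra EE0 => /andP[xE yE].
by apply/eqP/val_inj; have [-> _] := edge_of_mem xy xE yE.
Qed.

(* Double counting of the pairs (y, E) with x and y on E. *)
Lemma sum_edges_mem x : (\sum_(E : edge G) (x \in val E) = degree x)%N.
Proof.
have : (\sum_(y : G) \sum_(E : edge G) (x \in val E) * (y \in val E)
        = (\sum_(E : edge G) (x \in val E)) * 2)%N.
  rewrite exchange_big big_distrl /=; apply: eq_bigr => E _.
  by rewrite -big_distrr /= sum_mem_edge.
(* The term [y = x] is one copy of the wanted sum, so the terms [y != x] make up the other copy. *)
rewrite (bigD1 x) //= muln2 -addnn.
have -> : (\sum_(E : edge G) (x \in val E) * (x \in val E)
           = \sum_(E : edge G) (x \in val E))%N.
  by apply: eq_bigr => E _; rewrite mulnb andbb.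
move/eqP; rewrite eqn_add2l => /eqP <-; rewrite degreeE [RHS](bigD1 x) //=.
rewrite adj_irrefl; apply: eq_bigr => y yx.
by rewrite sum_edges_mem2 // eq_sym.
Qed.

(** Distinct edges meet in at most one vertex, so counting common vertices already gives adjacency
    in the line graph. *)
Lemma sum_mem2_edges E F : E != F ->
  (\sum_(x : G) (x \in val E) * (x \in val F) = (val E :&: val F != set0))%N.
Proof.
move=> EF; have -> : (\sum_(x : G) (x \in val E) * (x \in val F)
                      = #|val E :&: val F|)%N.
  rewrite -sum1_card [RHS]big_mkcond /=.
  by apply: eq_bigr => x _; rewrite inE; do 2!case: (x \in _).
rewrite -card_gt0; suff : (#|val E :&: val F| <= 1)%N by case: #|_| => [|[]].
rewrite leqNgt; apply: contra EF => /card_gt1P[x [y [+ + xy]]].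
rewrite !inE => /andP[xE xF] /andP[yE yF]; apply/eqP/val_inj.
by have [-> _] := edge_of_mem xy xE yE; have [-> _] := edge_of_mem xy xF yF.
Qed.

(** Each edge has two ends and each vertex lies on [t] edges. This later compares [m1] with [n1]. *)
Lemma regular_double_count t : regular G t -> (gsize G * 2 = gorder G * t)%N.
Proof.
move=> Gt; have -> : gsize G = #|edge G| by rewrite card_sig.
rewrite -!sum_nat_const -[LHS](eq_bigr _ (fun E _ => sum_mem_edge E)).
rewrite exchange_big; apply: eq_bigr => x _.
by rewrite sum_edges_mem Gt.
Qed.

(* The subtraction does not truncate: the edge [E] forces [0 < t]. *)
Lemma sum_edge_adj t E : regular G t ->
  (\sum_(F : edge G) ((E != F) && (val E :&: val F != set0)) = 2 * t - 2)%N.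
Proof.
move=> Gt; have : (\sum_(F : edge G) \sum_(x : G) (x \in val E) * (x \in val F)
                   = 2 * t)%N.
  rewrite exchange_big /= -(sum_mem_edge E) big_distrl /=.
  by apply: eq_bigr => x _; rewrite -big_distrr /= sum_edges_mem Gt.
rewrite (bigD1 E) //= => <-.
have -> : (\sum_(x : G) (x \in val E) * (x \in val E) = 2)%N.
  by rewrite -(sum_mem_edge E); apply: eq_bigr => x _; rewrite mulnb andbb.
rewrite addKn [LHS](bigD1 E) //= eqxx; apply: eq_bigr => F FE.
by rewrite sum_mem2_edges 1?eq_sym // FE.
Qed.

End Incidence.

(** * Vertex degrees in the join *)

Section JoinDegrees.
Variables (G1 G2 : sgraph) (t1 t2 : nat).
Hypotheses (G1t : regular G1 t1) (G2t : regular G2 t2).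

Lemma degree_join_vertex (x : G1) :
  degree (inl (inl x) : T_vjoin G1 G2) = (2 * t1 + gorder G2)%N.
Proof.
rewrite degreeE big_sumType big_sumType /= -degreeE sum_edges_mem !G1t.
by rewrite sum1_card mul2n addnn.
Qed.

Lemma degree_join_edge (E : edge G1) :
  degree (inl (inr E) : T_vjoin G1 G2) = (2 * t1)%N.
Proof.
rewrite degreeE big_sumType big_sumType /= sum_mem_edge (sum_edge_adj E G1t).
rewrite big1 // addn0 subnKC //.
have [x [y [xy _]]] := edgeP E.
suff : (0 < t1)%N by case: (t1) => // t _; rewrite mulnS.
by rewrite -(G1t x) degreeE (bigD1 y) //= xy.
Qed.

Lemma degree_join_right (y : G2) :
  degree (inr y : T_vjoin G1 G2) = (t2 + gorder G1)%N.
Proof.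
rewrite degreeE big_sumType big_sumType /= -degreeE G2t.
rewrite [in X in (_ + X + _)%N]big1 //.
by rewrite sum1_card addn0 addnC.
Qed.

End JoinDegrees.

(** Changing the enumeration applies one permutation to rows and columns alike, and its sign enters
    twice. This allows a block order other than that of [enum_val]. *)
Lemma det_reindex (R : comNzRingType) (T : finType) n (h : 'I_n -> T)
    (M : T -> T -> R) : bijective h ->
  \det (\matrix_(i, j) M (h i) (h j))
  = \det (\matrix_(i < #|T|, j < #|T|) M (enum_val i) (enum_val j)).
Proof.
move=> hbij; have nT : n = #|T| by rewrite -(bij_eq_card hbij) card_ord.
move: h hbij; rewrite nT => h hbij.
have hinj : injective (enum_rank \o h).
  by apply: inj_comp (bij_inj hbij); exact: enum_rank_inj.
have -> : \matrix_(i, j) M (h i) (h j)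
  = row_perm (perm hinj) (col_perm (perm hinj)
      (\matrix_(i < #|T|, j < #|T|) M (enum_val i) (enum_val j))).
  by apply/matrixP => i j; rewrite !mxE !permE /= !enum_rankK.
rewrite row_permE col_permE !det_mulmx !det_perm odd_permV mulrCA mulrA.
by rewrite -mulrA -signr_addb addbb mulr1.
Qed.

Lemma sum_enum_val (V : nmodType) (T : finType) (F : T -> V) :
  \sum_(k < #|T|) F (enum_val k) = \sum_x F x.
Proof. exact/esym/reindex/onW_bij/enum_val_bij. Qed.

(** * Adjacency and incidence matrices of regular graphs *)

Section GraphMatrices.
Variables (R : comNzRingType) (alpha : R).

Definition incidence_mx (G : sgraph) : 'M[R]_(#|G|, #|edge G|) :=
  \matrix_(i, j) ((enum_val i : G) \in val (enum_val j : edge G))%:R.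

Lemma tr_adj_mx G : (adj_mx R G)^T = adj_mx R G.
Proof. by apply/matrixP => i j; rewrite !mxE adj_sym. Qed.

Lemma tr_A_mx G : (A_mx alpha G)^T = A_mx alpha G.
Proof. by rewrite /A_mx linearD !linearZ /= tr_adj_mx tr_diag_mx. Qed.

Section Regular.
Variables (G : sgraph) (t : nat).
Hypothesis Gt : regular G t.

Lemma A_mx_regular : A_mx alpha G = (alpha * t%:R)%:M + (1 - alpha) *: adj_mx R G.
Proof.
by apply/matrixP => i j; rewrite !mxE Gt -mulrnAr.
Qed.

(** The diagonal gives [alpha * t] and the neighbours [(1 - alpha) * t]. Hence the all-ones vector
    is an eigenvector for [t]. *)
Lemma A_mx_row_sum i : \sum_j A_mx alpha G i j = t%:R.
Proof.
rewrite A_mx_regular; under eq_bigr do rewrite !mxE.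
rewrite big_split /= -big_distrr /= (bigD1 i) //=.
rewrite big1 ?eqxx ?addr0 => [|j /negPf]; last first.
  by rewrite eq_sym => ->.
have -> : \sum_(j < #|G|) (adj (enum_val i) (enum_val j))%:R = t%:R :> R.
  rewrite -(Gt (enum_val i)) degreeE natr_sum.
  by rewrite -(sum_enum_val (fun y : G => (adj (enum_val i) y)%:R)).
by rewrite mulr1n; ring.
Qed.

Lemma incidence_mulmx_tr :
  incidence_mx G *m (incidence_mx G)^T = adj_mx R G + t%:R%:M.
Proof.
apply/matrixP => i j; rewrite !mxE.
have -> : \sum_k incidence_mx G i k * (incidence_mx G)^T k j =
  (\sum_(E : edge G) (enum_val i \in val E) * (enum_val j \in val E))%:R.
  rewrite natr_sum -[RHS]sum_enum_val.
  by apply: eq_bigr => k _; rewrite !mxE natrM.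
have [<-|ij] := eqVneq i j.
  rewrite adj_irrefl add0r mulr1n; congr _%:R.
  rewrite -(Gt (enum_val i)) -sum_edges_mem; apply: eq_bigr => E _.
  by rewrite mulnb andbb.
by rewrite sum_edges_mem2 ?(inj_eq enum_val_inj) // mulr0n addr0.
Qed.

End Regular.

Lemma tr_incidence_mulmx G : (incidence_mx G)^T *m incidence_mx G =
  \matrix_(i, j) (@total_adj G (inr (enum_val i)) (inr (enum_val j)))%:R + 2%:M.
Proof.
apply/matrixP => i j; rewrite !mxE.
have -> : \sum_k (incidence_mx G)^T i k * incidence_mx G k j =
  (\sum_(x : G) (x \in val (enum_val i)) * (x \in val (enum_val j)))%:R.
  rewrite natr_sum -[RHS]sum_enum_val.
  by apply: eq_bigr => k _; rewrite !mxE natrM.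
have [<-|ij] := eqVneq i j.
  rewrite /= eqxx add0r mulr1n; congr _%:R.
  rewrite -(sum_mem_edge (enum_val i)); apply: eq_bigr => x _.
  by rewrite mulnb andbb.
by rewrite sum_mem2_edges /= (inj_eq enum_val_inj) ?ij // mulr0n addr0.
Qed.

End GraphMatrices.

(** * Block form of the matrix of the join *)

Section JoinMatrix.
Variables (G1 G2 : sgraph).

(** Original vertices come first, then edge vertices, then [G2]; the nested [split] matches the
    nested [block_mx]. *)
Definition join_enum (i : 'I_(#|G1| + #|edge G1| + #|G2|)) : T_vjoin G1 G2 :=
  match split i with
  | inl k => inl (match split k with
                  | inl u => inl (enum_val u)
                  | inr v => inr (enum_val v)
                  end)
  | inr w => inr (enum_val w)
  end.

Lemma join_enum_bij : bijective join_enum.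
Proof.
exists (fun v : T_vjoin G1 G2 => unsplit (match v with
  | inl a => inl (unsplit (match a with
                           | inl x => inl (enum_rank x)
                           | inr E => inr (enum_rank E)
                           end))
  | inr y => inr (enum_rank y)
  end)).
  move=> i; rewrite /join_enum -[RHS]splitK; congr unsplit.
  case: (split i) => [k|w]; last by rewrite enum_valK.
  congr inl; rewrite -[RHS]splitK; congr unsplit.
  by case: (split k) => u; rewrite enum_valK.
by case=> [[x|E]|y]; rewrite /join_enum unsplitK ?unsplitK enum_rankK.
Qed.

Variables (R : comNzRingType) (alpha : R) (t1 t2 : nat).
Hypotheses (G1t : regular G1 t1) (G2t : regular G2 t2).

(** The diagonal of [A_mx alpha G1] already holds one [alpha * t1] of the degree term. The product
    [B^T *m B] has diagonal 2, which [2 * c] compensates. *)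
Lemma horner_char_poly_join x :
  let c := 1 - alpha in
  let B := incidence_mx R G1 in
  (char_poly (A_mx alpha (T_vjoin G1 G2))).[x] = \det (block_mx
    (block_mx ((x - alpha * t1%:R - alpha * #|G2|%:R)%:M - A_mx alpha G1)
       (- c *: B) (- c *: B^T)
       ((x - 2 * alpha * t1%:R + 2 * c)%:M - c *: (B^T *m B)))
    (col_mx (const_mx (- c)) 0) (row_mx (const_mx (- c)) 0)
    ((x - alpha * #|G1|%:R)%:M - A_mx alpha G2)).
Proof.
move=> c B; rewrite horner_char_poly.
pose M (u v : T_vjoin G1 G2) : R :=
  (x - alpha * (degree u)%:R) *+ (u == v) - c * (adj u v)%:R.
have -> : x%:M - A_mx alpha (T_vjoin G1 G2)
          = \matrix_(i, j) M (enum_val i) (enum_val j).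
  apply/matrixP => i j; rewrite !mxE /M (inj_eq enum_val_inj) /c.
  by rewrite mulrnBl -mulrnAr opprD addrA.
rewrite -(det_reindex _ join_enum_bij); congr (\det _).
rewrite (A_mx_regular _ G1t) (A_mx_regular _ G2t) tr_incidence_mulmx.
apply/matrixP => i j; rewrite !mxE /M /join_enum.
have inlE (S T : eqType) (a b : S) : (inl a == inl b :> S + T) = (a == b) by [].
have inrE (S T : eqType) (a b : T) : (inr a == inr b :> S + T) = (a == b) by [].
case: (split i) => [i'|i']; rewrite !mxE; case: (split j) => [j'|j'];
  rewrite !mxE ?inlE ?inrE.
- case: (split i') => [u|u]; rewrite !mxE; case: (split j') => [v|v];
    rewrite !mxE ?inlE ?inrE.
  + rewrite (degree_join_vertex _ G1t) (inj_eq enum_val_inj) /gorder /=.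
    by case: (u == v) => /=; rewrite ?mulr1n ?mulr0n /c; ring.
  + by rewrite sub0r mulNr.
  + by rewrite sub0r mulNr.
  + rewrite (degree_join_edge _ G1t) !(inj_eq enum_val_inj) /=.
    by case: (u == v) => /=; rewrite ?mulr1n ?mulr0n /c; ring.
- by case: (split i') => u; rewrite !mxE /= ?mulr1 ?mulr0 ?oppr0 ?add0r.
- by case: (split j') => v; rewrite !mxE /= ?mulr1 ?mulr0 ?oppr0 ?add0r.
rewrite (degree_join_right _ G2t) (inj_eq enum_val_inj) /gorder /=.
by case: (i' == j') => /=; rewrite ?mulr1n ?mulr0n /c; ring.
Qed.

End JoinMatrix.

(** * Ordered spectrum of a regular graph *)

Section RegularSpectrum.
Variable R : rcfType.

Lemma det_shift_symmetric n (M : 'M[R]_n) x : M^T = M ->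
  \det (x%:M - M) = \prod_(l <- spectrum M) (x - l).
Proof.
move=> symM; rewrite -horner_char_poly char_poly_symmetric // horner_prod.
by apply: eq_bigr => l _; rewrite hornerXsubC.
Qed.

Lemma mem_spectrum n (M : 'M[R]_n) l : M^T = M ->
  (l \in spectrum M) = eigenvalue M l.
Proof.
by move=> symM; rewrite eigenvalue_root_char char_poly_symmetric // root_prod_XsubC.
Qed.

(** [lambda] counts from 1 and [nth] from 0, so the indices from 2 to [n] select the list without
    its head. *)
Lemma map_lambda (T : Type) n (M : 'M[R]_n) (f : R -> T) : M^T = M -> (0 < n)%N ->
  [seq f (lambda j M) | j <- index_iota 2 n.+1]
  = [seq f l | l <- behead (spectrum M)].
Proof.
move=> symM n0; rewrite /lambda (map_comp f) -drop1; congr map.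
have sz := size_spectrum symM; rewrite /index_iota subSS -[2%N]/(1 + 1)%N iotaDl.
rewrite -map_comp (eq_map (_ : _ =1 nth 0 (spectrum M))) //.
by rewrite map_nth_iota ?sz ?subnKC // take_oversize // size_drop sz.
Qed.

Variables (alpha : R) (G : sgraph) (t : nat).
Hypotheses (alpha_ge0 : 0 <= alpha) (alpha_le1 : alpha <= 1) (Gt : regular G t).
Local Notation M := (A_mx alpha G).

(* Compare both sides of the eigenvalue equation at an entry of maximal modulus. *)
Lemma spectrum_le l : l \in spectrum M -> l <= t%:R.
Proof.
rewrite mem_spectrum ?tr_A_mx // => /eigenvalueP[v vM v0].
have [i0 vi0] : exists i0, v 0 i0 != 0 by apply/rV0Pn.
pose i := [arg max_(j > i0) `|v 0 j|]%O.
have vmax j : `|v 0 j| <= `|v 0 i|.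
  by rewrite /i; case: arg_maxP => // k _ /(_ j isT).
have vi : 0 < `|v 0 i| by apply: lt_le_trans (vmax i0); rewrite normr_gt0.
(* Here the bounds on [alpha] enter. *)
have Mge0 j k : 0 <= M j k.
  rewrite (A_mx_regular _ Gt) !mxE; apply: addr_ge0.
    by rewrite mulrn_wge0 ?mulr_ge0.
  by rewrite mulr_ge0 ?subr_ge0.
rewrite -(ler_pM2r vi); apply: le_trans (_ : `|l * v 0 i| <= _).
  by rewrite normrM ler_wpM2r // ler_norm.
have -> : l * v 0 i = \sum_j v 0 j * M j i.
  by have /rowP/(_ i) := vM; rewrite !mxE => <-.
apply: le_trans (ler_norm_sum _ _ _) _.
rewrite -(A_mx_row_sum alpha Gt i) mulr_suml; apply: ler_sum => j _.
have -> : M i j = M j i.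
  by have /matrixP/(_ j i) := tr_A_mx alpha G; rewrite [LHS]mxE.
rewrite normrM (ger0_norm (Mge0 _ _)) mulrC.
by rewrite ler_wpM2l.
Qed.

(** The eigenvalue [t] of the all-ones vector bounds all others, so it heads the decreasing list.
    Further copies of [t], if any, stay in the tail. *)
Lemma spectrum_regular : (0 < #|G|)%N ->
  spectrum M = t%:R :: behead (spectrum M).
Proof.
move=> G0; have tM : t%:R \in spectrum M.
  rewrite mem_spectrum ?tr_A_mx //; apply/eigenvalueP.
  exists (const_mx 1); last first.
    by apply/rV0Pn; exists (Ordinal G0); rewrite mxE oner_neq0.
  apply: trmx_inj; rewrite trmx_mul tr_A_mx trmx_const.
  rewrite (mulmx_const1 _ (A_mx_row_sum alpha Gt)).
  by apply/matrixP => i j; rewrite !mxE mulr1.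
have le_t := spectrum_le.
have : sorted >=%R (spectrum M) by apply: sort_sorted => x y; exact: le_total.
case: (spectrum M) tM le_t => // l s /= tM le_t ls; congr (_ :: _).
apply: le_anti; rewrite le_t ?mem_head //=.
move: tM; rewrite inE => /predU1P[->//|ts].
by have /allP/(_ _ ts) := order_path_min ge_trans ls.
Qed.

End RegularSpectrum.

(** * Factorization of the characteristic polynomial of the join *)

Section JoinCharPoly.
Variables (R : rcfType) (alpha : R) (G1 G2 : sgraph) (t1 t2 : nat).
Hypotheses (alpha_ge0 : 0 <= alpha) (alpha_le1 : alpha <= 1).
Hypotheses (G1t : regular G1 t1) (G2t : regular G2 t2).
Hypotheses (n1_gt0 : (0 < #|G1|)%N) (n2_gt0 : (0 < #|G2|)%N).
Local Notation n1 := #|G1|.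
Local Notation n2 := #|G2|.
Local Notation N1 := (A_mx alpha G1).
Local Notation N2 := (A_mx alpha G2).

(** With [p], [q'], [c], [e] as in [det_total_join], this is [(p - l)(q' - l) - c(l + e)]: the
    quadratic in [N1] evaluated at an eigenvalue [l]. *)
Definition join_quadratic (l : R) : {poly R} :=
  'X^2 - (alpha * (t1%:R + n2%:R + 2) + t1%:R - 2 + 2 * l)%:P * 'X
  - ((1 - alpha) * (t1%:R - 2 * alpha * t1%:R + l))%:P
  + ((alpha * t1%:R + alpha * n2%:R + l) * (t1%:R - 2 + 2 * alpha + l))%:P.

(** For [t1 > 0], the characteristic polynomial of the 3 by 3 quotient matrix for the partition into
    [G2], original vertices and edge vertices. *)
Definition join_cubic : {poly R} :=
  ('X - (t2%:R + alpha * n1%:R)%:P)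
    * ('X - (t1%:R + alpha * t1%:R + alpha * n2%:R)%:P)
    * ('X + (2 - 2 * t1%:R - 2 * alpha)%:P)
  - (2 * t1%:R * (1 - alpha) ^+ 2)%:P * ('X - (alpha * n1%:R + t2%:R)%:P)
  - (n1%:R * n2%:R * (1 - alpha) ^+ 2)%:P * ('X + (2 - 2 * t1%:R - 2 * alpha)%:P).

Lemma join_quadratic_neq0 l : join_quadratic l != 0.
Proof.
apply/eqP => /(congr1 (fun p : {poly R} => p`_2)).
rewrite /join_quadratic !coefE /= mulr0 !subr0 addr0 => /eqP.
by rewrite oner_eq0.
Qed.

(** Both subtracted terms have degree at most one and cannot touch the leading term of the triple
    product. *)
Lemma size_join_cubic : size join_cubic = 4%N.
Proof.
have sz2 (k a : R) : (size (k%:P * ('X - a%:P) : {poly R})%R <= 2)%N.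
  by rewrite mul_polyC (leq_trans (size_scale_leq _ _)) ?size_XsubC.
pose c : R := - (2 - 2 * t1%:R - 2 * alpha).
rewrite /join_cubic -[(2 - _ - _)%:P]opprK -[- (2 - _ - _)%:P]polyCN -/c.
set a := t2%:R + _; set b := t1%:R + _ + _.
have s3 : size (('X - a%:P) * ('X - b%:P) * ('X - c%:P)) = 4%N.
  by have := size_prod_XsubC [:: a; b; c] id; rewrite !big_cons big_nil mulr1 mulrA.
have szM3 (p q : {poly R}) : size p = 4%N -> (size q <= 2)%N -> size (p - q) = 4%N.
  by move=> sp sq; rewrite size_polyDl sp // size_polyN (leq_ltn_trans sq).
by rewrite !szM3 //.
Qed.

(** Powers of the linear factor stay on both sides because [#|edge G1|] may be smaller than [#|G1|].
    The heads [t1] and [t2] of the two spectra are left out of the products; their factors merge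
    into [join_cubic]. *)
Lemma char_poly_join :
  ('X - (2 * alpha * (t1%:R + 1) - 2)%:P) ^+ #|G1|
    * char_poly (A_mx alpha (T_vjoin G1 G2))
  = ('X - (2 * alpha * (t1%:R + 1) - 2)%:P) ^+ #|edge G1|
    * ((\prod_(l <- behead (spectrum N2)) ('X - (alpha * n1%:R + l)%:P))
    * ((\prod_(l <- behead (spectrum N1)) join_quadratic l) * join_cubic)).
Proof.
pose q0 : R := 2 * alpha * (t1%:R + 1) - 2; rewrite -/q0.
(* Chosen so that [c *: (B *m B^T) = N1 + e%:M], where [c = 1 - alpha]. *)
pose e : R := (1 - 2 * alpha) * t1%:R.
(* Off the roots of [r], everything inverted below is invertible. The second factor takes care of
   [Q] through Sylvester's identity. *)
pose r := ('X - q0%:P) * \prod_(l <- spectrum N1) ('X - (q0 + e + l)%:P)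
  * \prod_(l <- spectrum N2) ('X - (alpha * n1%:R + l)%:P)
  * \prod_(l <- spectrum N1) join_quadratic l.
have s1 := spectrum_regular alpha_ge0 alpha_le1 G1t n1_gt0.
have s2 := spectrum_regular alpha_ge0 alpha_le1 G2t n2_gt0.
apply: (@poly_eq_off_roots _ _ _ r).
  rewrite !mulf_neq0 ?polyXsubC_eq0 // prodf_seq_neq0; apply/allP => l _ /=.
  - by rewrite polyXsubC_eq0.
  - by rewrite polyXsubC_eq0.
  - exact: join_quadratic_neq0.
move=> x; rewrite /r !hornerM !horner_prod !mulf_eq0 !negb_or hornerXsubC.
move=> /andP[/andP[/andP[x_q0 x_Q] x_S] x_P].
pose c := 1 - alpha.
pose p := x - alpha * t1%:R - alpha * n2%:R.
pose q := x - 2 * alpha * t1%:R + 2 * c.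
pose s := x - alpha * n1%:R.
have qE : q = x - q0 by rewrite /q /q0 /c; ring.
have q_neq0 : q != 0 by rewrite qE.
have BB : c *: (incidence_mx R G1 *m (incidence_mx R G1)^T) = N1 + e%:M.
  rewrite (A_mx_regular _ G1t) (incidence_mulmx_tr _ G1t) scalerDr scale_scalar_mx.
  rewrite addrC addrAC -raddfD /=; congr (_%:M + _).
  by rewrite /c /e; ring.
have quadE l : (join_quadratic l).[x]
    = p * (q - e) - c * e + - (p + (q - e) + c) * l + 1 * l ^+ 2.
  rewrite /join_quadratic !(hornerD, hornerN, hornerM, hornerXn, hornerX, hornerC).
  by rewrite /p /q /e /c; ring.
have detS : \det (s%:M - N2)
    = (s - t2%:R) * \prod_(l <- behead (spectrum N2)) (s - l).
  by rewrite det_shift_symmetric ?tr_A_mx // s2 big_cons.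
have Q_unit : q%:M - c *: ((incidence_mx R G1)^T *m incidence_mx R G1) \in unitmx.
  have := det_sylvester (incidence_mx R G1) (c *: (incidence_mx R G1)^T) q_neq0.
  rewrite -scalemxAl -scalemxAr BB opprD addrA addrAC -raddfB.
  rewrite [\det (_ - N1)]det_shift_symmetric ?tr_A_mx // unitmxE unitfE => E.
  apply: contraNneq
    (_ : q ^+ #|edge G1| * \prod_(l <- spectrum N1) (q - e - l) != 0).
    by rewrite -E => ->; rewrite mulr0.
  rewrite mulf_neq0 ?expf_neq0 //.
  move: x_Q; rewrite !prodf_seq_neq0; apply: sub_all => l /=.
  by rewrite hornerXsubC qE !opprD !addrA.
have S_unit : s%:M - N2 \in unitmx.
  rewrite unitmxE unitfE det_shift_symmetric ?tr_A_mx //.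
  move: x_S; rewrite !prodf_seq_neq0; apply: sub_all => l /=.
  by rewrite hornerXsubC opprD addrA.
have detP := det_quadratic_symmetric (p * (q - e) - c * e) (- (p + (q - e) + c)) 1
  (tr_A_mx alpha G1).
have P_unit : (p * (q - e) - c * e)%:M + - (p + (q - e) + c) *: N1 + 1 *: (N1 *m N1)
    \in unitmx.
  rewrite unitmxE unitfE detP; move: x_P; rewrite !prodf_seq_neq0.
  by apply: sub_all => l /=; rewrite quadE.
have f_neq0 : (join_quadratic t1%:R).[x] != 0.
  by move: x_P; rewrite s1 big_cons mulf_eq0 negb_or => /andP[].
have s_neq0 : s - t2%:R != 0.
  move: x_S; rewrite s2 big_cons mulf_eq0 negb_or => /andP[+ _].
  by rewrite hornerXsubC opprD addrA.
have := det_total_join BB (A_mx_row_sum alpha G1t) (A_mx_row_sum alpha G2t)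
  q_neq0 Q_unit S_unit P_unit; rewrite -quadE => /(_ f_neq0 s_neq0).
rewrite !horner_exp hornerXsubC -qE (horner_char_poly_join _ G1t G2t).
move=> ->; rewrite detS detP s1 big_cons -quadE /=.
have -> : \prod_(l <- behead (spectrum N1)) (join_quadratic l).[x] =
  \prod_(l <- behead (spectrum N1))
    (p * (q - e) - c * e + - (p + (q - e) + c) * l + 1 * l ^+ 2).
  by apply: eq_bigr => l _; rewrite quadE.
have -> : \prod_(l <- behead (spectrum N2)) ('X - (alpha * n1%:R + l)%:P).[x] =
  \prod_(l <- behead (spectrum N2)) (s - l).
  by apply: eq_bigr => l _; rewrite hornerXsubC opprD addrA.
(* This is the rank one factor times [(s - t2) * f], that is, with its denominator cleared by the
   two head factors. *)
have -> : join_cubic.[x] = (s - t2%:R) * (join_quadratic t1%:R).[x]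
  - c ^+ 2 * n1%:R * n2%:R * (q - e - t1%:R).
  rewrite quadE /join_cubic !(hornerD, hornerN, hornerM, hornerX, hornerC).
  by rewrite /s /p /q /e /c; ring.
move: (\prod_(l <- _) _) (\prod_(l <- _) _) (join_quadratic _).[x] f_neq0 (q ^+ _).
by move=> P1 P2 f f_neq0 qm; field; rewrite f_neq0 s_neq0.
Qed.

End JoinCharPoly.

(** * Reading the spectrum off the factorization *)

Lemma spectrum_perm (R : rcfType) n (M : 'M[R]_n) :
  perm_eq (spectrum M) (real_roots (char_poly M)).
Proof. by rewrite perm_sort. Qed.

(** The list in (a) has [n2 + 3] entries, while for [t1 = 1] the join has [n1 + n1 / 2 + n2]
    vertices; these agree exactly when [n1 = 2]. *)
Theorem corollary5p1 (R : rcfType) (alpha : R) (G1 G2 : sgraph)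
    (t1 n1 m1 t2 n2 : nat)
    (alpha_ge0 : 0 <= alpha) (alpha_le1 : alpha <= 1)
    (G1_regular : regular G1 t1) (G1_order : gorder G1 = n1)
    (G1_size : gsize G1 = m1) (n1_gt0 : (0 < n1)%N)
    (G2_regular : regular G2 t2) (G2_order : gorder G2 = n2)
    (n2_gt0 : (0 < n2)%N) :
  (t1 = 1%N -> n1 = 2%N ->
    let cubic : {poly R} :=
      ('X - (2 * alpha)%:P) * ('X - (2 * alpha + t2%:R)%:P)
        * ('X - (1 + alpha + alpha * n2%:R)%:P)
      - (2 * n2%:R * (1 - alpha) ^+ 2)%:P * ('X - (2 * alpha)%:P)
      - (2 * (1 - alpha) ^+ 2)%:P * ('X - (2 * alpha + t2%:R)%:P) in
    size (real_roots cubic) = 3%N /\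
    perm_eq (spectrum (A_mx alpha (T_vjoin G1 G2)))
      ([:: alpha * (3 + n2%:R) - 1]
       ++ [seq 2 * alpha + lambda j (A_mx alpha G2) | j <- index_iota 2 n2.+1]
       ++ real_roots cubic))
  /\
  ((2 <= t1)%N ->
    let quadratic (i : nat) : {poly R} :=
      let l := lambda i (A_mx alpha G1) in
      'X^2 - (alpha * (t1%:R + n2%:R + 2) + t1%:R - 2 + 2 * l)%:P * 'X
      - ((1 - alpha) * (t1%:R - 2 * alpha * t1%:R + l))%:P
      + ((alpha * t1%:R + alpha * n2%:R + l)
          * (t1%:R - 2 + 2 * alpha + l))%:P in
    let cubic : {poly R} :=
      ('X - (t2%:R + alpha * n1%:R)%:P)
        * ('X - (t1%:R + alpha * t1%:R + alpha * n2%:R)%:P)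
        * ('X + (2 - 2 * t1%:R - 2 * alpha)%:P)
      - (2 * t1%:R * (1 - alpha) ^+ 2)%:P * ('X - (alpha * n1%:R + t2%:R)%:P)
      - (n1%:R * n2%:R * (1 - alpha) ^+ 2)%:P
          * ('X + (2 - 2 * t1%:R - 2 * alpha)%:P) in
    size (real_roots cubic) = 3%N /\
    perm_eq (spectrum (A_mx alpha (T_vjoin G1 G2)))
      (nseq (m1 - n1) (2 * alpha * (t1%:R + 1) - 2)
       ++ [seq alpha * n1%:R + lambda j (A_mx alpha G2)
            | j <- index_iota 2 n2.+1]
       ++ flatten [seq real_roots (quadratic i) | i <- index_iota 2 n1.+1]
       ++ real_roots cubic)).
Proof.
have edgesE : #|edge G1| = m1 by rewrite -G1_size card_sig.
have n1E : #|G1| = n1 by [].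
have n2E : #|G2| = n2 by [].
have count := regular_double_count G1_regular; rewrite G1_size G1_order in count.
have n1_gt0' : (0 < #|G1|)%N by rewrite n1E.
have n2_gt0' : (0 < #|G2|)%N by rewrite n2E.
have chi := char_poly_join alpha_ge0 alpha_le1
  G1_regular G2_regular n1_gt0' n2_gt0'.
set q := 'X - (2 * alpha * (t1%:R + 1) - 2)%:P in chi.
have q_neq0 : q != 0 by rewrite polyXsubC_eq0.
have cubic_neq0 : join_cubic alpha G1 G2 t1 t2 != 0.
  by rewrite -size_poly_gt0 size_join_cubic.
have size_cubic :
    join_cubic alpha G1 G2 t1 t2 %| char_poly (A_mx alpha (T_vjoin G1 G2)) ->
    size (real_roots (join_cubic alpha G1 G2 t1 t2)) = 3%N.
  rewrite char_poly_symmetric ?tr_A_mx // => /(size_real_roots_dvd cubic_neq0) ->.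
  by rewrite size_join_cubic.
have prodX (s : seq R) (k : R) :
    \prod_(l <- s) ('X - (k + l)%:P)
    = \prod_(l <- [seq k + l | l <- s]) ('X - l%:P).
  by rewrite big_map.
have prod_neq0 (s : seq R) : \prod_(l <- s) ('X - l%:P) != 0.
  exact/monic_neq0/monic_prod_XsubC.
split=> [t1E n1E2 cubic|t1_ge2 quadratic cubic].
  have m1E : m1 = 1%N.
    by apply/eqP; rewrite -(eqn_pmul2r (isT : 0 < 2)%N) count n1E2 t1E.
  have -> : cubic = join_cubic alpha G1 G2 t1 t2.
    apply: (@poly_eq_off_roots _ _ _ 1); rewrite ?oner_neq0 // => x _.
    rewrite /cubic /join_cubic n1E n2E n1E2 t1E.
    by rewrite !(hornerD, hornerN, hornerM, hornerX, hornerC); ring.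
  have s1 := spectrum_regular alpha_ge0 alpha_le1 G1_regular n1_gt0'.
  (* One of the two eigenvalues is 1 and the trace is [2 * alpha]. *)
  have l2 : behead (spectrum (A_mx alpha G1)) = [:: 2 * alpha - 1].
    have trE : \tr (A_mx alpha G1) = 2 * alpha.
      rewrite (A_mx_regular _ G1_regular) mxtraceD mxtrace_scalar mxtraceZ.
      rewrite [\tr (adj_mx _ _)]big1 => [|i _]; last by rewrite mxE adj_irrefl.
      by rewrite n1E n1E2 t1E; ring.
    have sz : size (spectrum (A_mx alpha G1)) = 2%N.
      by rewrite size_spectrum ?tr_A_mx // n1E n1E2.
    have := sum_spectrum (tr_A_mx alpha G1); move: sz; rewrite trE s1 t1E.
    case: (behead _) => [//|l [|//]] _ /=.
    by rewrite !big_cons big_nil => E; congr [:: _]; lra.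
  (* This extra [q] makes up for having [q ^+ 2] on the left of [chi] but only one [q] on the
     right. *)
  have quadE : join_quadratic alpha G2 t1 (2 * alpha - 1)
      = q * ('X - (alpha * (3 + n2%:R) - 1)%:P).
    apply: (@poly_eq_off_roots _ _ _ 1); rewrite ?oner_neq0 // => x _.
    rewrite /q /join_quadratic n2E t1E.
    by rewrite !(hornerD, hornerN, hornerM, hornerXn, hornerX, hornerC); ring.
  have {}chi : char_poly (A_mx alpha (T_vjoin G1 G2)) =
      (\prod_(l <- [:: alpha * (3 + n2%:R) - 1]
        ++ [seq 2 * alpha + l | l <- behead (spectrum (A_mx alpha G2))])
        ('X - l%:P)) * join_cubic alpha G1 G2 t1 t2.
    apply: (mulfI (expf_neq0 2 q_neq0)).
    have {1}-> : q ^+ 2 = q ^+ #|G1| by rewrite n1E n1E2.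
    rewrite chi edgesE m1E l2 big_seq1 quadE cat1s big_cons prodX n1E n1E2.
    by rewrite [alpha * 2%:R]mulrC; ring.
  split; first by rewrite size_cubic // chi dvdp_mull.
  rewrite (permPl (spectrum_perm _)) chi (permPl (real_rootsM _ _)) //.
  rewrite catA perm_cat2r (permPl (real_roots_split _)) -n2E.
  by rewrite (@map_lambda _ _ _ _ (fun l => 2 * alpha + l)) ?tr_A_mx.
(* From [m1 * 2 = n1 * t1] and [2 <= t1]; hence [m1 - n1] is not truncated. *)
have le_n1m1 : (n1 <= m1)%N.
  by rewrite -(leq_pmul2r (isT : 0 < 2)%N) count leq_mul2l t1_ge2 orbT.
have -> : cubic = join_cubic alpha G1 G2 t1 t2 by rewrite /cubic -n1E -n2E.
set Q := behead (spectrum (A_mx alpha G1)).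
have {}chi : char_poly (A_mx alpha (T_vjoin G1 G2)) =
    (\prod_(l <- nseq (m1 - n1) (2 * alpha * (t1%:R + 1) - 2)
       ++ [seq alpha * n1%:R + l | l <- behead (spectrum (A_mx alpha G2))])
       ('X - l%:P))
    * (\prod_(l <- Q) join_quadratic alpha G2 t1 l * join_cubic alpha G1 G2 t1 t2).
  apply: (mulfI (expf_neq0 n1 q_neq0)).
  have {1}-> : q ^+ n1 = q ^+ #|G1| by rewrite n1E.
  have n1R : #|G1|%:R = n1%:R :> R by rewrite n1E.
  rewrite chi edgesE prodX n1R big_cat big_nseq -/q /= iter_mulr mulr1.
  by rewrite -{1}(subnKC le_n1m1) exprD !mulrA.
have quads_neq0 : \prod_(l <- Q) join_quadratic alpha G2 t1 l != 0.
  by rewrite prodf_seq_neq0; apply/allP => l _; exact: join_quadratic_neq0.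
split; first by rewrite size_cubic // chi !dvdp_mull.
rewrite (permPl (spectrum_perm _)) chi (permPl (real_rootsM _ _)) ?mulf_neq0 //.
rewrite catA perm_cat //.
  rewrite (permPl (real_roots_split _)) -n2E.
  by rewrite (@map_lambda _ _ _ _ (fun l => alpha * n1%:R + l)) ?tr_A_mx.
rewrite (permPl (real_rootsM _ _)) // perm_cat2r.
rewrite (permPl (real_roots_prod _ _)); last exact: join_quadratic_neq0.
pose f l := real_roots (join_quadratic alpha G2 t1 l).
rewrite -n1E -(@map_lambda _ _ _ _ f) ?tr_A_mx //.
by rewrite /f /join_quadratic n2E.
Qed.
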